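(* Let $\tau \in L^2(\mathbb{Z})$ be the element $\tau = \sum_{n=1}^\infty (-1)^{n+1}\,(q^n - q^{-n})/n$, i.e. the square-summable function $\mathbb{Z}\to\mathbb{C}$ with $\tau_0 = 0$ and $\tau_n = (-1)^{n+1}/n$ for every nonzero integer $n$. Then $\exp(\tau) = q$; that is, all the convolution powers $\tau, \tau^2, \tau^3, \ldots$ lie in $L^2(\mathbb{Z})$, and the series $1 + \tau + \tau^2/2! + \tau^3/3! + \cdots$ converges in $L^2(\mathbb{Z})$ to $q$.
   Context: $L^2(\mathbb{Z})$ denotes the Hilbert space of square-summable functions $\psi:\mathbb{Z}\to\mathbb{C}$, $n\mapsto\psi_n$. An element $\psi$ is written as a formal Laurent series $\sum_{n\in\mathbb{Z}} \psi_n q^n$, so $q^k$ denotes the function taking value $1$ at $k$ and $0$ elsewhere; in particular $1 = q^0$ and $q = q^1$. (Here $q$ is a generator of the pure braid group on two strands, which is isomorphic to $\mathbb{Z}$.) Multiplication is convolution: $(\varphi\psi)_n = \sum_{k\in\mathbb{Z}} \varphi_k\psi_{n-k}$. Convolution powers are defined by $\tau^0 = 1$ and $\tau^m = \tau^{m-1}\tau$ for $m\ge 1$. *)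

(* Defs.v *)
From Stdlib Require Import Reals ZArith.
From Coquelicot Require Import Coquelicot.

Open Scope R_scope.

(* Sums over Z are split into two one-sided series, n >= 0 and n < 0, which
   are required to converge separately (no principal-value cancellation). *)
Definition ex_Zseries (a : Z -> R) : Prop :=
  ex_series (fun n : nat => a (Z.of_nat n)) /\
  ex_series (fun n : nat => a (- Z.of_nat (S n))%Z).

Definition ZSeries (a : Z -> R) : R :=
  Series (fun n : nat => a (Z.of_nat n)) +
  Series (fun n : nat => a (- Z.of_nat (S n))%Z).

Definition CZSeries (a : Z -> C) : C :=
  (ZSeries (fun k => Re (a k)), ZSeries (fun k => Im (a k))).

(* Membership in L^2(Z), for a function Z -> C. *)
Definition L2 (psi : Z -> C) : Prop :=
  ex_Zseries (fun n => Cmod (psi n) ^ 2).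

(* Meaningful for [psi] in L^2(Z) only: [Series] is a total operator. *)
Definition L2norm (psi : Z -> C) : R :=
  sqrt (ZSeries (fun n => Cmod (psi n) ^ 2)).

(* The monomial q^k; [qpow 0] is the unit 1 and [qpow 1] is q. *)
Definition qpow (k : Z) : Z -> C :=
  fun n => if Z.eq_dec n k then RtoC 1 else RtoC 0.

(* If [phi] and [psi] are in L^2(Z), all the sums below converge absolutely
   by Cauchy-Schwarz, so no default value of [Series] is involved. *)
Definition conv (phi psi : Z -> C) : Z -> C :=
  fun n => CZSeries (fun k => Cmult (phi k) (psi (n - k)%Z)).

Fixpoint conv_pow (tau : Z -> C) (m : nat) : Z -> C :=
  match m with
  | O => qpow 0
  | S m' => conv (conv_pow tau m') tau
  end.

(* The L^2 conditions make the [L2norm] in the last clause meaningful. *)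
Definition L2_converges (u : nat -> Z -> C) (l : Z -> C) : Prop :=
  (forall N : nat, L2 (u N)) /\ L2 l /\
  is_lim_seq (fun N => L2norm (fun n => Cminus (u N n) (l n))) 0.

Definition exp_partial_sum (tau : Z -> C) (N : nat) : Z -> C :=
  fun n => sum_n (fun m => Cdiv (conv_pow tau m n) (RtoC (INR (fact m)))) N.

Definition tau : Z -> C :=
  fun n => if Z.eq_dec n 0 then RtoC 0
           else RtoC (powerRZ (-1) (n + 1) / IZR n).

(* Main.v *)
Require Import Defs.
From Stdlib Require Import Reals ZArith Lra Lia List.
From Coquelicot Require Import Coquelicot.

Open Scope R_scope.

(* The numbers tau_n are the Fourier coefficients of the function t |-> it on
   (-pi, pi), so convolution by tau corresponds to multiplication by it, the
   m-th convolution power of tau is the sequence of Fourier coefficients of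
   (it)^m, and the partial sums of exp(tau) are those of the partial sums of
   e^{it}, whose coefficient sequence is q. Only Bessel's inequality is needed
   to pass from the uniform convergence of the exponential series to convergence
   in L^2(Z). That multiplication by it becomes convolution by tau amounts to
   Parseval's identity for t |-> it, that is, to sum 1/n^2 = pi^2/6, which is
   obtained from the integrals of cos^(2n) and t^2 cos^(2n) over [0, pi/2]. *)

(** * Unordered sums over the integers *)

Definition lsum (h : Z -> R) (L : list Z) : R :=
  fold_right (fun k s => h k + s) 0 L.

Lemma lsum_app (h : Z -> R) (L M : list Z) :
  lsum h (L ++ M) = lsum h L + lsum h M.
Proof. induction L as [|k L IH]; simpl; [lra | rewrite IH; lra]. Qed.

Lemma lsum_map (h : Z -> R) (s : Z -> Z) (L : list Z) :
  lsum h (map s L) = lsum (fun k => h (s k)) L.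
Proof. induction L as [|k L IH]; simpl; [reflexivity | now rewrite IH]. Qed.

Lemma lsum_ext (h g : Z -> R) (L : list Z) :
  (forall k, h k = g k) -> lsum h L = lsum g L.
Proof.
  intros E; induction L as [|k L IH]; simpl; [reflexivity | now rewrite IH, E].
Qed.

Lemma lsum_nonneg (h : Z -> R) (L : list Z) :
  (forall k, 0 <= h k) -> 0 <= lsum h L.
Proof.
  intros P; induction L as [|k L IH]; simpl; [lra | specialize (P k); lra].
Qed.

(** Each entry of [L] is cancelled against one occurrence in [M]; [NoDup L] ensures that the
    remaining entries survive the removal. *)
Lemma lsum_incl (h : Z -> R) (P : forall k, 0 <= h k) (L M : list Z) :
  NoDup L -> incl L M -> lsum h L <= lsum h M.
Proof.
  intros D; revert M; induction D as [|k L kL D IH]; intros M I.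
  - now apply lsum_nonneg.
  - destruct (in_split k M) as (M1 & M2 & ->); [now apply I; left|].
    assert (J : incl L (M1 ++ M2)).
    { intros x xL. specialize (I x (or_intror xL)).
      apply in_app_or in I; destruct I as [I|[<-|I]].
      - now apply in_or_app; left.
      - contradiction.
      - now apply in_or_app; right. }
    specialize (IH _ J). rewrite lsum_app in *; simpl in *; lra.
Qed.

(** Convergence along the net of finite sets of integers, represented by lists without repetition.
    Unlike [ZSeries], this notion is visibly invariant under permutations of the index set. *)
Definition has_Zsum (h : Z -> R) (l : R) : Prop :=
  forall eps, 0 < eps -> exists L0, forall L,
    NoDup L -> incl L0 L -> Rabs (lsum h L - l) < eps.

(** The sum is the supremum of the finite sums: a finite set coming within [eps] of it serves as
    [L0], since adding nonnegative terms only moves closer. *)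
Lemma bounded_has_Zsum (h : Z -> R) (B : R) :
  (forall k, 0 <= h k) -> (forall L, NoDup L -> lsum h L <= B) ->
  exists l, has_Zsum h l /\ l <= B.
Proof.
  intros P HB.
  destruct (completeness (fun x => exists L, NoDup L /\ x = lsum h L))
    as (l & Hub & Hlub).
  - exists B; intros x (L & D & ->); auto.
  - exists 0, nil; split; [constructor | reflexivity].
  - exists l; split.
    + intros eps Heps.
      destruct (Classical_Prop.classic
        (exists L, NoDup L /\ l - eps < lsum h L)) as [(L0 & D0 & H0)|N].
      * exists L0; intros L D I.
        assert (lsum h L0 <= lsum h L) by now apply lsum_incl.
        assert (lsum h L <= l) by (apply Hub; now exists L).
        apply Rabs_def1; lra.
      * enough (l <= l - eps) by lra.
        apply Hlub; intros x (L & D & ->).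
        destruct (Rle_lt_dec (lsum h L) (l - eps)); [easy|].
        exfalso; apply N; now exists L.
    + apply Hlub; intros x (L & D & ->); auto.
Qed.

Lemma list_Zabs_bounded (L : list Z) :
  exists N : nat, forall k, In k L -> (Z.abs k < Z.of_nat N)%Z.
Proof.
  induction L as [|k L (N & IH)].
  - exists 0%nat; intros k [].
  - exists (N + S (Z.to_nat (Z.abs k)))%nat; intros x [->|xL]; [lia|].
    specialize (IH x xL); lia.
Qed.

Lemma sum_n_lsum (h : Z -> R) (phi : nat -> Z) (N : nat) :
  sum_n (fun n => h (phi n)) N = lsum h (map phi (seq 0 (S N))).
Proof.
  induction N as [|N IH].
  - rewrite sum_O; simpl; ring.
  - rewrite sum_Sn, IH, (seq_S (S N)), map_app, lsum_app; simpl.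
    unfold plus; simpl; ring.
Qed.

Lemma NoDup_map_inj (phi : nat -> Z) (a n : nat) :
  (forall i j, phi i = phi j -> i = j) -> NoDup (map phi (seq a n)).
Proof.
  intros inj; apply NoDup_map_NoDup_ForallPairs; [|apply seq_NoDup].
  intros x y _ _; apply inj.
Qed.

Lemma has_Zsum_ex_series (h : Z -> R) (l : R) (phi : nat -> Z) :
  (forall i j, phi i = phi j -> i = j) ->
  (forall i, (Z.of_nat i <= Z.abs (phi i))%Z) ->
  has_Zsum h l -> ex_series (fun n => h (phi n)).
Proof.
  intros inj big Hl.
  cut (ex_finite_lim_seq (sum_n (fun n => h (phi n)))); [easy|].
  apply ex_lim_seq_cauchy_corr; intros eps.
  destruct (Hl (eps / 2)) as (L0 & HL0).
  { destruct eps; simpl; lra. }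
  destruct (list_Zabs_bounded L0) as (N & HN).
  exists N.
  (* The block of indices from [N] to [n] has sum [t] and avoids [L0], because |phi i| >= i. Joined
     to [L0] it is an admissible list, so [t] is within eps/2 of a number independent of [n]. *)
  assert (T : forall n, (N <= n)%nat -> exists t,
    sum_n (fun n => h (phi n)) n = lsum h (map phi (seq 0 N)) + t /\
    Rabs (lsum h (nodup Z.eq_dec L0) + t - l) < eps / 2).
  { intros n Hn. exists (lsum h (map phi (seq N (S n - N)))); split.
    - rewrite sum_n_lsum, <- lsum_app, <- map_app.
      replace (S n) with (N + (S n - N))%nat at 1 by lia.
      now rewrite seq_app.
    - rewrite <- lsum_app; apply HL0.
      + apply NoDup_app; [apply NoDup_nodup | now apply NoDup_map_inj |].
        intros k K1 K2; apply nodup_In, HN in K1.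
        apply in_map_iff in K2; destruct K2 as (i & <- & I).
        apply in_seq in I; specialize (big i); lia.
      + intros k K; apply in_or_app; left; now apply nodup_In. }
  intros n m Hn Hm.
  destruct (T n Hn) as (t & -> & Ht), (T m Hm) as (u & -> & Hu).
  apply Rabs_def2 in Ht, Hu; apply Rabs_def1; lra.
Qed.

Lemma has_Zsum_ex (h : Z -> R) (l : R) : has_Zsum h l -> ex_Zseries h.
Proof.
  intros H; split.
  - apply (has_Zsum_ex_series h l Z.of_nat); auto; lia.
  - apply (has_Zsum_ex_series h l (fun n => - Z.of_nat (S n))%Z); auto; lia.
Qed.

(** Adding the two partial sums of rank N gives the sum over the integers from -(N+1) to N, a finite
    set that ends up containing any given [L0]. *)
Lemma has_Zsum_ZSeries (h : Z -> R) (l : R) : has_Zsum h l -> ZSeries h = l.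
Proof.
  intros H; destruct (has_Zsum_ex h l H) as (E1 & E2).
  apply Series_correct in E1, E2; unfold ZSeries.
  set (s1 := Series (fun n => h (Z.of_nat n))) in *.
  set (s2 := Series (fun n => h (- Z.of_nat (S n))%Z)) in *.
  assert (A : is_lim_seq (fun N => sum_n (fun n => h (Z.of_nat n)) N +
    sum_n (fun n => h (- Z.of_nat (S n))%Z) N) (s1 + s2))
    by exact (is_lim_seq_plus' _ _ s1 s2 E1 E2).
  assert (B : is_lim_seq (fun N => sum_n (fun n => h (Z.of_nat n)) N +
    sum_n (fun n => h (- Z.of_nat (S n))%Z) N) l).
  { apply is_lim_seq_spec; intros eps.
    destruct (H eps (cond_pos eps)) as (L0 & HL0).
    destruct (list_Zabs_bounded L0) as (N & HN).
    exists N; intros n Hn.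
    rewrite (sum_n_lsum h Z.of_nat), (sum_n_lsum h (fun n => - Z.of_nat (S n))%Z).
    rewrite <- lsum_app; apply HL0.
    - apply NoDup_app; [apply NoDup_map_inj; lia | apply NoDup_map_inj; lia |].
      intros k K1 K2; apply in_map_iff in K1, K2.
      destruct K1 as (i & <- & _), K2 as (j & E & _); lia.
    - intros k K; apply HN in K; apply in_or_app.
      destruct (Z_lt_le_dec k 0) as [Hk|Hk].
      + right; apply in_map_iff; exists (Z.to_nat (- k - 1)); split; [lia|].
        apply in_seq; lia.
      + left; apply in_map_iff; exists (Z.to_nat k); split; [lia|].
        apply in_seq; lia. }
  apply is_lim_seq_unique in A, B; rewrite A in B; now injection B.
Qed.

Lemma has_Zsum_zero : has_Zsum (fun _ => 0) 0.
Proof.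
  intros eps Heps; exists nil; intros L _ _.
  replace (lsum (fun _ => 0) L) with 0.
  - now rewrite Rminus_0_r, Rabs_R0.
  - induction L as [|k L IH]; simpl; [reflexivity | rewrite <- IH; ring].
Qed.

(** The map k |-> n - k moves the cut between the two one-sided series, so the substitution is made
    on the unordered sum. *)
Lemma has_Zsum_reflect (h : Z -> R) (l : R) (n : Z) :
  has_Zsum h l -> has_Zsum (fun k => h (n - k)%Z) l.
Proof.
  intros H eps Heps; destruct (H eps Heps) as (L0 & HL0).
  exists (map (fun k => n - k)%Z L0); intros L D I.
  rewrite <- (lsum_map h (fun k => n - k)%Z); apply HL0.
  - apply NoDup_map_NoDup_ForallPairs; auto; intros x y _ _; lia.
  - intros k K; apply in_map_iff; exists (n - k)%Z; split; [lia|].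
    apply I, in_map_iff; exists k; split; [lia | easy].
Qed.

(** * Fourier coefficients on the circle *)

Definition cont (f : R -> R) : Prop := forall x, continuous f x.

Lemma cont_const (c : R) : cont (fun _ => c).
Proof. intros x; apply continuous_const. Qed.

Lemma cont_id : cont (fun t => t).
Proof. intros x; apply continuous_id. Qed.

Lemma cont_plus (f g : R -> R) : cont f -> cont g -> cont (fun t => f t + g t).
Proof. intros Hf Hg x; apply (continuous_plus f g x); auto. Qed.

Lemma cont_minus (f g : R -> R) : cont f -> cont g -> cont (fun t => f t - g t).
Proof. intros Hf Hg x; apply (continuous_minus f g x); auto. Qed.

Lemma cont_opp (f : R -> R) : cont f -> cont (fun t => - f t).
Proof. intros Hf x; apply (continuous_opp f x); auto. Qed.

Lemma cont_mult (f g : R -> R) : cont f -> cont g -> cont (fun t => f t * g t).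
Proof. intros Hf Hg x; apply (continuous_mult f g x); auto. Qed.

Lemma cont_pow (f : R -> R) (n : nat) : cont f -> cont (fun t => f t ^ n).
Proof.
  intros Hf; induction n as [|n IH]; simpl; [apply cont_const|].
  now apply cont_mult.
Qed.

Lemma cont_cos (f : R -> R) : cont f -> cont (fun t => cos (f t)).
Proof. intros Hf x; now apply continuous_cos_comp. Qed.

Lemma cont_sin (f : R -> R) : cont f -> cont (fun t => sin (f t)).
Proof. intros Hf x; now apply continuous_sin_comp. Qed.

Lemma cont_lsum (h : Z -> R -> R) (L : list Z) :
  (forall k, cont (h k)) -> cont (fun t => lsum (fun k => h k t) L).
Proof.
  intros Hh; induction L as [|k L IH]; simpl; [apply cont_const|].
  now apply cont_plus.
Qed.

Ltac cont :=
  lazymatch goal with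
  | |- cont (fun _ => ?c) => apply (cont_const c)
  | |- cont (fun t => t) => apply cont_id
  | |- cont (fun t => @?f t + @?g t) => apply (cont_plus f g); cont
  | |- cont (fun t => @?f t - @?g t) => apply (cont_minus f g); cont
  | |- cont (fun t => - @?f t) => apply (cont_opp f); cont
  | |- cont (fun t => @?f t * @?g t) => apply (cont_mult f g); cont
  | |- cont (fun t => @?f t ^ ?n) => apply (cont_pow f n); cont
  | |- cont (fun t => cos (@?f t)) => apply (cont_cos f); cont
  | |- cont (fun t => sin (@?f t)) => apply (cont_sin f); cont
  | |- cont (fun t => lsum (fun k => @?h t k) ?L) =>
      apply (cont_lsum (fun k t => h t k) L); intros ?; cont
  | |- cont _ => assumption
  | |- _ => idtac
  end.

Definition rint (f : R -> R) (a b : R) : R := RInt f a b.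

Lemma cont_ex_RInt (f : R -> R) (a b : R) : cont f -> ex_RInt f a b.
Proof.
  intros Hf; apply (ex_RInt_continuous (V := R_CompleteNormedModule)).
  intros z _; apply Hf.
Qed.

Lemma rint_plus (f g : R -> R) (a b : R) : cont f -> cont g ->
  rint (fun t => f t + g t) a b = rint f a b + rint g a b.
Proof. intros Hf Hg; apply (RInt_plus f g); now apply cont_ex_RInt. Qed.

Lemma rint_scal (f : R -> R) (c a b : R) : cont f ->
  rint (fun t => c * f t) a b = c * rint f a b.
Proof. intros Hf; apply (RInt_scal f); now apply cont_ex_RInt. Qed.

Lemma rint_lin (f g : R -> R) (c a b : R) : cont f -> cont g ->
  rint (fun t => f t + c * g t) a b = rint f a b + c * rint g a b.
Proof. intros Hf Hg; rewrite rint_plus, rint_scal by cont; reflexivity. Qed.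

Lemma rint_eq (f g : R -> R) (a b : R) :
  (forall t, f t = g t) -> rint f a b = rint g a b.
Proof. intros E; apply RInt_ext; auto. Qed.

Lemma rint_derive (F f : R -> R) (a b : R) :
  (forall t, is_derive F t (f t)) -> cont f -> rint f a b = F b - F a.
Proof.
  intros HF Hf; apply is_RInt_unique.
  apply (is_RInt_derive F f); intros x _; auto.
Qed.

Lemma rint_le (f g : R -> R) (a b : R) : a <= b -> cont f -> cont g ->
  (forall t, a < t < b -> f t <= g t) -> rint f a b <= rint g a b.
Proof. intros; apply RInt_le; auto using cont_ex_RInt. Qed.

Lemma rint_const (c : R) : rint (fun _ => c) (- PI) PI = 2 * PI * c.
Proof.
  transitivity ((PI - - PI) * c); [exact (RInt_const (- PI) PI c) | ring].
Qed.

(** * Bessel's inequality and coefficients of products *)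

Definition contC (F : R -> C) : Prop :=
  cont (fun t => fst (F t)) /\ cont (fun t => snd (F t)).

(** The squared modulus, as a polynomial in the components rather than through the square root in
    [Cmod]. *)
Definition nsq (z : C) : R := fst z ^ 2 + snd z ^ 2.

(* The real part of the Fourier coefficient (2 pi)^-1 int F(t) e^{-int} dt. *)
Definition coef (F : R -> C) (n : Z) : R :=
  rint (fun t => fst (F t) * cos (IZR n * t) + snd (F t) * sin (IZR n * t))
    (- PI) PI / (2 * PI).

(** The trigonometric polynomial with terms c_k e^{ikt}, for real c_k. *)
Definition trig (c : Z -> R) (L : list Z) (t : R) : C :=
  (lsum (fun k => c k * cos (IZR k * t)) L,
   lsum (fun k => c k * sin (IZR k * t)) L).

Lemma sin_IZR_PI (n : Z) : sin (IZR n * PI) = 0.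
Proof. apply sin_eq_0_1; now exists n. Qed.

Lemma rint_cos (n : Z) :
  rint (fun t => cos (IZR n * t)) (- PI) PI = if Z.eq_dec n 0 then 2 * PI else 0.
Proof.
  destruct (Z.eq_dec n 0) as [->|Hn].
  - rewrite (rint_eq _ (fun _ => 1)), rint_const; [ring|].
    intros t; rewrite Rmult_0_l; apply cos_0.
  - assert (H : IZR n <> 0) by now apply not_0_IZR.
    rewrite (rint_derive (fun t => sin (IZR n * t) / IZR n)).
    + replace (IZR n * - PI) with (- (IZR n * PI)) by ring.
      rewrite sin_neg, sin_IZR_PI; field; auto.
    + intros t; auto_derive; auto; field; auto.
    + cont.
Qed.

Lemma trig_orth (c : Z -> R) (L : list Z) (k : Z) : ~ In k L ->
  rint (fun t => fst (trig c L t) * cos (IZR k * t) +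
                 snd (trig c L t) * sin (IZR k * t)) (- PI) PI = 0.
Proof.
  induction L as [|l L IH]; intros N.
  - rewrite (rint_eq _ (fun _ => 0)), rint_const; [ring|]; simpl; intros; ring.
  (* Re(e^{ilt} e^{-ikt}) = cos((l - k) t), whose integral vanishes because l differs from k. *)
  - rewrite (rint_eq _ (fun t =>
      (fst (trig c L t) * cos (IZR k * t) + snd (trig c L t) * sin (IZR k * t))
      + c l * cos (IZR (l - k) * t))).
    + unfold trig in *; simpl in *.
      rewrite rint_lin, rint_cos, IH by (cont; intros I; apply N; now right).
      destruct (Z.eq_dec (l - k) 0); [|ring].
      exfalso; apply N; left; lia.
    + intros t; unfold trig; simpl.
      rewrite minus_IZR, Rmult_minus_distr_r, cos_minus; ring.
Qed.

Lemma coef_int (F : R -> C) (n : Z) :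
  rint (fun t => fst (F t) * cos (IZR n * t) + snd (F t) * sin (IZR n * t))
    (- PI) PI = 2 * PI * coef F n.
Proof. unfold coef; field; apply PI_neq0. Qed.

(** With z = F - trig over [L], one more frequency gives |z - c e^{ikt}|^2 = |z|^2 - 2 c Re(z
    e^{-ikt}) + c^2. Integrated, the [F] part of the cross term contributes -4 pi c^2, the [trig]
    part 0 by orthogonality, and the last term 2 pi c^2. *)
Lemma Bessel_identity (F : R -> C) (L : list Z) : contC F -> NoDup L ->
  rint (fun t => nsq (Cminus (F t) (trig (coef F) L t))) (- PI) PI =
  rint (fun t => nsq (F t)) (- PI) PI - 2 * PI * lsum (fun k => coef F k ^ 2) L.
Proof.
  intros (C1 & C2) D; induction D as [|k L N D IH].
  - simpl; rewrite Rmult_0_r, Rminus_0_r; apply rint_eq; intros t.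
    unfold nsq; simpl; ring.
  - set (c := coef F) in *.
    rewrite (rint_eq _ (fun t =>
      (((nsq (Cminus (F t) (trig c L t)) +
      (- 2 * c k) * (fst (F t) * cos (IZR k * t) + snd (F t) * sin (IZR k * t)))
      + (2 * c k) * (fst (trig c L t) * cos (IZR k * t) +
         snd (trig c L t) * sin (IZR k * t)))) + c k ^ 2)).
    + assert (contC (trig c L)) as (T1 & T2).
      { unfold trig; split; simpl; cont. }
      assert (cont (fun t => nsq (Cminus (F t) (trig c L t)))).
      { unfold nsq; simpl; cont. }
      rewrite rint_plus, 2!rint_lin, IH, coef_int, rint_const by cont.
      rewrite trig_orth by assumption.
      simpl; fold c; ring.
    + intros t; unfold nsq, trig; simpl.
      generalize (sin2_cos2 (IZR k * t)); unfold Rsqr.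
      generalize (sin (IZR k * t)) (cos (IZR k * t)); intros s d E.
      set (x := lsum _ L); set (y := lsum _ L).
      replace (c k * (c k * 1)) with (c k * (c k * 1) * (s * s + d * d))
        by (rewrite E; ring).
      ring.
Qed.

Lemma nsq_nonneg (z : C) : 0 <= nsq z.
Proof. unfold nsq; nra. Qed.

Lemma Bessel_inequality (F : R -> C) (L : list Z) : contC F -> NoDup L ->
  lsum (fun k => coef F k ^ 2) L <=
  rint (fun t => nsq (F t)) (- PI) PI / (2 * PI).
Proof.
  intros CF D; generalize (Bessel_identity F L CF D); intros E.
  assert (0 <= rint (fun t => nsq (Cminus (F t) (trig (coef F) L t))) (- PI) PI).
  { destruct CF; generalize PI_RGT_0; intros.
    apply RInt_ge_0; [lra | | intros; apply nsq_nonneg].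
    apply cont_ex_RInt; unfold nsq, trig; simpl; cont. }
  generalize PI_RGT_0; intros.
  apply Rmult_le_reg_l with (2 * PI); [lra|].
  replace (2 * PI * (rint (fun t => nsq (F t)) (- PI) PI / (2 * PI))) with
    (rint (fun t => nsq (F t)) (- PI) PI) by (field; lra).
  lra.
Qed.

(** Multiplication by e^{ikt} shifts Fourier coefficients by k, and the c_k are real, so they
    commute with taking real parts. *)
Lemma coef_mult_trig (F G : R -> C) (c : Z -> R) (L : list Z) (n : Z) :
  contC F -> contC G ->
  coef (fun t => Cmult (F t) (Cminus (G t) (trig c L t))) n =
  coef (fun t => Cmult (F t) (G t)) n -
  lsum (fun k => c k * coef F (n - k)) L.
Proof.
  intros (F1 & F2) (G1 & G2).
  apply Rmult_eq_reg_l with (2 * PI); [|generalize PI_RGT_0; lra].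
  rewrite Rmult_minus_distr_l, <- 2!coef_int.
  induction L as [|k L IH].
  - simpl; rewrite Rmult_0_r, Rminus_0_r; apply rint_eq; intros t; ring.
  - simpl in *.
    rewrite (rint_eq _ (fun t =>
      ((fst (F t) * (fst (G t) + - fst (trig c L t)) -
        snd (F t) * (snd (G t) + - snd (trig c L t))) * cos (IZR n * t) +
       (fst (F t) * (snd (G t) + - snd (trig c L t)) +
        snd (F t) * (fst (G t) + - fst (trig c L t))) * sin (IZR n * t)) +
      (- c k) * (fst (F t) * cos (IZR (n - k) * t) +
               snd (F t) * sin (IZR (n - k) * t)))).
    + unfold trig in *; simpl in *.
      rewrite rint_lin, IH, coef_int by cont; ring.
    + intros t; rewrite minus_IZR, (Rmult_minus_distr_r (IZR n)), cos_minus, sin_minus.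
      unfold trig; simpl; ring.
Qed.

(* Integrated form of |Re(z w e^{-int})| <= (eps |z|^2 + |w|^2 / eps) / 2. *)
Lemma coef_mult_bound (F H : R -> C) (n : Z) (eps : R) :
  contC F -> contC H -> 0 < eps ->
  Rabs (2 * PI * coef (fun t => Cmult (F t) (H t)) n) <=
  (eps * rint (fun t => nsq (F t)) (- PI) PI +
   / eps * rint (fun t => nsq (H t)) (- PI) PI) / 2.
Proof.
  intros (F1 & F2) (H1 & H2) He; generalize PI_RGT_0; intros HP.
  assert (He' : 0 < / eps) by now apply Rinv_0_lt_compat.
  assert (KF : cont (fun t => nsq (F t))) by (unfold nsq; cont).
  assert (KH : cont (fun t => nsq (H t))) by (unfold nsq; cont).
  rewrite <- coef_int; simpl.
  set (u := rint _ _ _).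
  (* The signs s = 1 and s = -1 give the two halves of the absolute value. *)
  assert (B : forall s, s ^ 2 = 1 -> s * u <=
    (eps * rint (fun t => nsq (F t)) (- PI) PI +
     / eps * rint (fun t => nsq (H t)) (- PI) PI) / 2).
  { intros s Hs; unfold u; rewrite <- rint_scal by cont.
    replace ((eps * rint (fun t => nsq (F t)) (- PI) PI +
     / eps * rint (fun t => nsq (H t)) (- PI) PI) / 2) with
     (rint (fun t => (eps / 2) * nsq (F t) + (/ eps / 2) * nsq (H t)) (- PI) PI)
     by (rewrite rint_plus, 2!rint_scal by cont; field; lra).
    apply rint_le; [lra | cont | cont |].
    intros t _; unfold nsq.
    generalize (sin2_cos2 (IZR n * t)); unfold Rsqr.
    generalize (sin (IZR n * t)) (cos (IZR n * t)); intros y x E.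
    generalize (fst (F t)) (snd (F t)) (fst (H t)) (snd (H t)).
    intros a b c d.
    (* [p - iq] is s F(t) e^{-int}, which has the modulus of F(t), and [p * c + q * d] is the real
       part of its product with H(t). The inequality is then the expanded sum of squares [Q]. *)
    set (p := s * (a * x + b * y)); set (q := s * (a * y - b * x)).
    replace (a ^ 2 + b ^ 2) with (p ^ 2 + q ^ 2)
      by (unfold p, q; transitivity (s ^ 2 * (a ^ 2 + b ^ 2) * (y * y + x * x));
          [ring | rewrite Hs, E; ring]).
    replace (s * _) with (p * c + q * d) by (unfold p, q; ring).
    assert (Q : 0 <= / eps / 2 * ((eps * p - c) ^ 2 + (eps * q - d) ^ 2)).
    { apply Rmult_le_pos; [lra |].
      apply Rplus_le_le_0_compat; apply pow2_ge_0. }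
    replace (/ eps / 2 * ((eps * p - c) ^ 2 + (eps * q - d) ^ 2)) with
      (eps / 2 * (p ^ 2 + q ^ 2) + / eps / 2 * (c ^ 2 + d ^ 2) - (p * c + q * d))
      in Q by (field; lra).
    lra. }
  apply Rabs_le; split; [specialize (B (-1)) | specialize (B 1)]; lra.
Qed.

Lemma coef_sqr_ZSeries (F : R -> C) : contC F ->
  ex_Zseries (fun n => coef F n ^ 2) /\
  ZSeries (fun n => coef F n ^ 2) <=
    rint (fun t => nsq (F t)) (- PI) PI / (2 * PI).
Proof.
  intros CF; destruct (bounded_has_Zsum (fun n => coef F n ^ 2)
    (rint (fun t => nsq (F t)) (- PI) PI / (2 * PI))) as (l & Hl & B).
  - intros k; nra.
  - intros L D; now apply Bessel_inequality.
  - split; [now apply has_Zsum_ex with l|].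
    now rewrite (has_Zsum_ZSeries _ l).
Qed.

(** * The sum of the reciprocal squares *)

(** Wallis integral I_n; [cosJ] is its analogue J_n with the weight t^2. *)
Definition cosI (n : nat) : R := rint (fun t => cos t ^ (n + n)) 0 (PI / 2).

Definition cosJ (n : nat) : R :=
  rint (fun t => t ^ 2 * cos t ^ (n + n)) 0 (PI / 2).

Lemma cosI_rec (n : nat) :
  2 * INR (S n) * cosI (S n) = (2 * INR n + 1) * cosI n.
Proof.
  unfold cosI.
  assert (E : rint (fun t => 2 * INR (S n) * cos t ^ (S n + S n) +
    - (2 * INR n + 1) * cos t ^ (n + n)) 0 (PI / 2) = 0).
  (* The derivative of this function is cos^(2n+2) - (2n+1) sin^2 cos^(2n), and it vanishes at both
     endpoints. *)
  { rewrite (rint_derive (fun t => sin t * cos t ^ (n + n + 1))).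
    - rewrite sin_0, cos_PI2, pow_add; ring.
    - intros t; auto_derive; auto.
      replace (pred (n + n + 1)) with (n + n)%nat by lia.
      replace (S n + S n)%nat with (n + n + 2)%nat by lia.
      rewrite !pow_add, !plus_INR.
      change (INR 2) with 2; change (INR 1) with 1; rewrite S_INR.
      generalize (sin2_cos2 t); unfold Rsqr; intros E.
      transitivity (cos t ^ (n + n) * cos t ^ 2 -
        (sin t * sin t) * ((2 * INR n + 1) * cos t ^ (n + n))).
      { rewrite !pow_add; ring. }
      rewrite !pow_add.
      replace (sin t * sin t) with (1 - cos t * cos t) by lra.
      ring.
    - cont. }
  rewrite rint_lin, rint_scal in E by cont; lra.
Qed.

Lemma cosJ_rec (n : nat) :
  cosI (S n) + 2 * INR (S n) ^ 2 * cosJ (S n) =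
  INR (S n) * (2 * INR n + 1) * cosJ n.
Proof.
  unfold cosI, cosJ.
  assert (E : rint (fun t => (cos t ^ (S n + S n) +
    2 * INR (S n) ^ 2 * (t ^ 2 * cos t ^ (S n + S n))) +
    - (INR (S n) * (2 * INR n + 1)) * (t ^ 2 * cos t ^ (n + n))) 0 (PI / 2) = 0).
  (* Two integrations by parts of cos^(2n+2), integrating first the factor 1 and then t, leave this
     boundary term, which is zero at 0 and at pi/2. *)
  { rewrite (rint_derive (fun t => t * cos t ^ (n + n + 2) +
      INR (S n) * (t ^ 2 * sin t * cos t ^ (n + n + 1)))).
    - rewrite sin_0, cos_PI2, !pow_add; ring.
    - intros t; auto_derive; auto.
      replace (pred (n + n + 1)) with (n + n)%nat by lia.
      replace (pred (n + n + 2)) with (n + n + 1)%nat by lia.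
      replace (S n + S n)%nat with (n + n + 2)%nat by lia.
      change (match n with O => 1 | S _ => INR n + 1 end) with (INR (S n)).
      rewrite !pow_add, !plus_INR.
      change (INR 2) with 2; change (INR 1) with 1; rewrite S_INR.
      generalize (sin2_cos2 t); unfold Rsqr; intros E.
      generalize dependent (sin t); intros s E.
      transitivity ((s * s) * (- (INR n + 1) * (2 * INR n + 1) * t ^ 2 *
         cos t ^ (n + n)) + cos t ^ (n + n) * cos t ^ 2 +
         (INR n + 1) * t ^ 2 * cos t ^ (n + n) * cos t ^ 2).
      + rewrite !pow_add; ring.
      + replace (s * s) with (1 - cos t * cos t) by lra; rewrite !pow_add; ring.
    - cont. }
  rewrite 2!rint_lin in E by cont; lra.
Qed.

(** The difference sin x - x cos x is 0 at 0 and has derivative x sin x >= 0 on the interval. *)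
Lemma mul_cos_le_sin (t : R) : 0 <= t <= PI / 2 -> t * cos t <= sin t.
Proof.
  intros Ht; destruct (MVT_gen (fun x => sin x - x * cos x) 0 t
    (fun x => x * sin x)) as (c & Hc & E).
  - intros x _; auto_derive; auto; ring.
  - intros x _; apply continuity_pt_filterlim.
    assert (H : cont (fun y => sin y - y * cos y)) by cont; apply H.
  - rewrite sin_0 in E.
    rewrite Rmin_left, Rmax_right in Hc by lra.
    assert (0 <= sin c) by (apply sin_ge_0; generalize PI_RGT_0; lra).
    assert (0 <= c * sin c * (t - 0)).
    { apply Rmult_le_pos; [apply Rmult_le_pos|]; lra. }
    lra.
Qed.

(** By [mul_cos_le_sin], t^2 cos^2 t <= sin^2 t = 1 - cos^2 t on the interval; multiply by cos^(2n)
    t and integrate. *)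
Lemma cosJ_le (n : nat) : cosJ (S n) <= cosI n - cosI (S n).
Proof.
  replace (cosI n - cosI (S n)) with (cosI n + (-1) * cosI (S n)) by ring.
  unfold cosI, cosJ; rewrite <- rint_lin by cont.
  apply rint_le; [generalize PI_RGT_0; lra | cont | cont |].
  intros t Ht.
  replace (S n + S n)%nat with (2 + (n + n))%nat by lia; rewrite pow_add.
  assert (0 <= cos t) by (apply cos_ge_0; lra).
  assert (H1 : t * cos t <= sin t) by (apply mul_cos_le_sin; lra).
  assert (H2 : 0 <= t * cos t) by (apply Rmult_le_pos; lra).
  assert (H3 : (t * cos t) ^ 2 <= sin t ^ 2) by (apply pow_incr; lra).
  generalize (sin2_cos2 t); unfold Rsqr; intros E.
  replace (sin t ^ 2) with (1 - cos t ^ 2) in H3 by lra.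
  assert (0 <= cos t ^ (n + n)) by now apply pow_le.
  replace (t ^ 2 * (cos t ^ 2 * cos t ^ (n + n))) with
    ((t * cos t) ^ 2 * cos t ^ (n + n)) by ring.
  replace (cos t ^ (n + n) + -1 * (cos t ^ 2 * cos t ^ (n + n))) with
    ((1 - cos t ^ 2) * cos t ^ (n + n)) by ring.
  now apply Rmult_le_compat_r.
Qed.

Lemma cosI_0 : cosI 0 = PI / 2.
Proof.
  unfold cosI; simpl; rewrite (rint_derive (fun t => t)); [ring | | cont].
  intros t; auto_derive; auto.
Qed.

Lemma cosJ_0 : cosJ 0 = PI ^ 3 / 24.
Proof.
  unfold cosJ; simpl; rewrite (rint_derive (fun t => t ^ 3 / 3)).
  - field.
  - intros t; auto_derive; auto; simpl; field.
  - cont.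
Qed.

Lemma cosI_pos (n : nat) : 0 < cosI n.
Proof.
  induction n as [|n IH].
  - rewrite cosI_0; generalize PI_RGT_0; lra.
  - generalize (cosI_rec n) (pos_INR n); rewrite S_INR; intros E P.
    apply Rmult_lt_reg_l with (2 * (INR n + 1)); [lra|].
    rewrite E, Rmult_0_r; apply Rmult_lt_0_compat; lra.
Qed.

Fixpoint zeta2 (K : nat) : R :=
  match K with O => 0 | S n => zeta2 n + / INR (S n) ^ 2 end.

(* The two recurrences combine into
   1/n^2 = 2 (J_(n-1)/I_(n-1) - J_n/I_n), which telescopes. *)
Lemma zeta2_eq (K : nat) : zeta2 K = PI ^ 2 / 6 - 2 * (cosJ K / cosI K).
Proof.
  generalize PI_RGT_0; intros P.
  induction K as [|n IH].
  (* J_0 / I_0 = pi^2 / 12, so the right-hand side starts at 0. *)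
  - simpl zeta2; rewrite cosI_0, cosJ_0; field; lra.
  - simpl zeta2; rewrite IH.
    generalize (cosI_rec n) (cosJ_rec n) (cosI_pos n) (cosI_pos (S n)).
    change (match n with O => 1 | S _ => INR n + 1 end) with (INR (S n)).
    assert (N : 0 < INR (S n)) by (apply lt_0_INR; lia).
    generalize dependent (INR (S n)); intros m N.
    generalize (2 * INR n + 1) (cosI n) (cosI (S n)) (cosJ n) (cosJ (S n)).
    intros a i i' j j' E1 E2 Hi Hi'.
    assert (Ha : a = 2 * m * i' / i) by (rewrite E1; field; lra).
    rewrite Ha in E2.
    assert (Hj : j / i = (i' + 2 * m ^ 2 * j') / (2 * m ^ 2 * i')).
    { rewrite E2; field; repeat split; lra. }
    rewrite Hj; field; repeat split; lra.
Qed.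

(** Since (2n+1) I_n = (2n+2) I_(n+1), the bound I_n - I_(n+1) of [cosJ_le] equals I_(n+1) / (2n+1),
    so that J_(n+1) / I_(n+1) <= 1 / (2n+1). *)
Lemma zeta2_lower_bound (n : nat) :
  PI ^ 2 / 6 - 2 / (2 * INR n + 1) <= zeta2 (S n).
Proof.
  rewrite zeta2_eq.
  generalize (cosI_rec n) (cosJ_le n) (cosI_pos n) (cosI_pos (S n)) (pos_INR n).
  rewrite S_INR; intros E1 E2 P1 P2 P3.
  enough (cosJ (S n) / cosI (S n) <= 1 / (2 * INR n + 1)) by lra.
  apply Rmult_le_reg_r with (cosI (S n) * (2 * INR n + 1)).
  - apply Rmult_lt_0_compat; lra.
  - replace (cosJ (S n) / cosI (S n) * (cosI (S n) * (2 * INR n + 1)))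
      with ((2 * INR n + 1) * cosJ (S n)) by (field; lra).
    replace (1 / (2 * INR n + 1) * (cosI (S n) * (2 * INR n + 1)))
      with (cosI (S n)) by (field; lra).
    assert ((2 * INR n + 1) * cosJ (S n) <=
      (2 * INR n + 1) * (cosI n - cosI (S n))) by (apply Rmult_le_compat_l; lra).
    lra.
Qed.

(** * The powers of the function t |-> it *)

Definition it (t : R) : C := (0, t).

Fixpoint itpow (m : nat) (t : R) : C :=
  match m with O => RtoC 1 | S m' => Cmult (itpow m' t) (it t) end.

Lemma contC_Cmult (F G : R -> C) :
  contC F -> contC G -> contC (fun t => Cmult (F t) (G t)).
Proof. intros (F1 & F2) (G1 & G2); split; simpl; cont. Qed.

Lemma contC_Cplus (F G : R -> C) :
  contC F -> contC G -> contC (fun t => Cplus (F t) (G t)).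
Proof. intros (F1 & F2) (G1 & G2); split; simpl; cont. Qed.

Lemma contC_const (z : C) : contC (fun _ => z).
Proof. split; simpl; cont. Qed.

Lemma contC_it : contC it.
Proof. split; simpl; cont. Qed.

Lemma contC_itpow (m : nat) : contC (itpow m).
Proof.
  induction m as [|m IH]; simpl; [apply contC_const|].
  apply (contC_Cmult (itpow m) it IH contC_it).
Qed.

Lemma cos_INR_PI (k : nat) : cos (INR k * PI) = (-1) ^ k.
Proof.
  induction k as [|k IH]; [now rewrite Rmult_0_l, cos_0|].
  rewrite S_INR, Rmult_plus_distr_r, Rmult_1_l, neg_cos, IH; simpl; ring.
Qed.

Lemma cos_IZR_PI (n : Z) : cos (IZR n * PI) = powerRZ (-1) n.
Proof.
  destruct (Z_le_gt_dec 0 n) as [H|H].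
  - rewrite <- (Z2Nat.id n H), <- INR_IZR_INZ, cos_INR_PI.
    apply pow_powerRZ.
  - replace n with (- Z.of_nat (Z.to_nat (- n)))%Z by lia.
    rewrite opp_IZR, Ropp_mult_distr_l_reverse, cos_neg, <- INR_IZR_INZ.
    rewrite cos_INR_PI, powerRZ_neg', <- pow_powerRZ.
    generalize (Z.to_nat (- n)); intros k.
    (* (-1)^k is its own inverse, so the sign of the exponent is immaterial. *)
    assert (E : (-1) ^ k * (-1) ^ k = 1).
    { rewrite <- Rpow_mult_distr.
      replace (-1 * -1) with 1 by ring; apply pow1. }
    apply Rmult_eq_reg_l with ((-1) ^ k).
    + rewrite E, Rinv_r; [reflexivity|].
      intros E'; rewrite E' in E; lra.
    + intros E'; rewrite E' in E; lra.
Qed.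

Lemma coef_it (n : Z) :
  coef it n = if Z.eq_dec n 0 then 0 else - cos (IZR n * PI) / IZR n.
Proof.
  generalize PI_RGT_0; intros P.
  apply Rmult_eq_reg_l with (2 * PI); [|lra].
  rewrite <- coef_int; simpl.
  destruct (Z.eq_dec n 0) as [->|Hn].
  - rewrite (rint_eq _ (fun _ => 0)), rint_const; [ring|].
    intros t; rewrite !Rmult_0_l, sin_0; ring.
  - assert (H : IZR n <> 0) by now apply not_0_IZR.
    rewrite (rint_derive (fun t =>
      - t * cos (IZR n * t) / IZR n + sin (IZR n * t) / IZR n ^ 2)).
    + replace (IZR n * - PI) with (- (IZR n * PI)) by ring.
      rewrite sin_neg, cos_neg, sin_IZR_PI; field; auto.
    + intros t; auto_derive; auto; field; auto.
    + cont.
Qed.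

Lemma tau_coef (n : Z) : tau n = RtoC (coef it n).
Proof.
  rewrite coef_it, cos_IZR_PI; unfold tau.
  destruct (Z.eq_dec n 0); [reflexivity|].
  rewrite powerRZ_add by lra; simpl powerRZ at 2; f_equal; unfold Rdiv; ring.
Qed.

(** * Mean-square convergence of the Fourier series of t |-> it *)

Fixpoint sym_range (K : nat) : list Z :=
  match K with
  | O => nil
  | S n => Z.of_nat (S n) :: (- Z.of_nat (S n))%Z :: sym_range n
  end.

Lemma sym_range_bound (K : nat) (k : Z) :
  In k (sym_range K) -> (Z.abs k <= Z.of_nat K)%Z.
Proof.
  induction K as [|K IH]; simpl sym_range; intros H; [destruct H|].
  destruct H as [<-|[<-|H]]; [lia | lia |].
  specialize (IH H); lia.
Qed.

Lemma sym_range_NoDup (K : nat) : NoDup (sym_range K).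
Proof.
  induction K as [|K IH]; simpl sym_range; constructor; [|constructor]; auto.
  - intros [H|H]; [lia|]; apply sym_range_bound in H; lia.
  - intros H; apply sym_range_bound in H; lia.
Qed.

Lemma coef_it_sqr (n : Z) : n <> 0%Z -> coef it n ^ 2 = / IZR n ^ 2.
Proof.
  intros Hn; rewrite coef_it; destruct (Z.eq_dec n 0); [contradiction|].
  assert (H : IZR n <> 0) by now apply not_0_IZR.
  generalize (sin2_cos2 (IZR n * PI)); rewrite sin_IZR_PI; unfold Rsqr; intros E.
  replace ((- cos (IZR n * PI) / IZR n) ^ 2) with
    ((0 * 0 + cos (IZR n * PI) * cos (IZR n * PI)) * / IZR n ^ 2) by (field; auto).
  rewrite E; ring.
Qed.

Lemma lsum_coef_it (K : nat) :
  lsum (fun k => coef it k ^ 2) (sym_range K) = 2 * zeta2 K.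
Proof.
  induction K as [|K IH]; [simpl; ring|].
  set (n := Z.of_nat (S K)).
  change (coef it n ^ 2 +
    (coef it (- n) ^ 2 + lsum (fun k => coef it k ^ 2) (sym_range K)) =
    2 * (zeta2 K + / INR (S K) ^ 2)).
  rewrite IH, 2!coef_it_sqr, opp_IZR, INR_IZR_INZ by lia; fold n.
  replace ((- IZR n) ^ 2) with (IZR n ^ 2) by ring; ring.
Qed.

(** By Bessel's identity the error is the integral 2 pi^3 / 3 of t^2 minus 2 pi times a sum of
    squares. Over [sym_range] that sum is twice [zeta2], which tends to pi^2 / 3, and further
    frequencies only enlarge it. *)
Lemma trig_it_converges (eps : R) : 0 < eps -> exists L0, forall L,
  NoDup L -> incl L0 L ->
  rint (fun t => nsq (Cminus (it t) (trig (coef it) L t))) (- PI) PI < eps.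
Proof.
  intros He; generalize PI_RGT_0; intros P.
  (* By [zeta2_lower_bound] the error is at most 2 pi times 4 / (2n+1), that is 8 pi / (2n+1),
     whence this choice of [n]. *)
  destruct (INR_unbounded (8 * PI / eps)) as (n & Hn).
  exists (sym_range (S n)); intros L D I.
  rewrite (Bessel_identity it L contC_it D).
  assert (B := zeta2_lower_bound n).
  assert (M : lsum (fun k => coef it k ^ 2) (sym_range (S n)) <=
    lsum (fun k => coef it k ^ 2) L).
  { apply lsum_incl; auto using sym_range_NoDup; intros k; apply pow2_ge_0. }
  rewrite lsum_coef_it in M.
  assert (E : rint (fun t => nsq (it t)) (- PI) PI = 2 * PI ^ 3 / 3).
  { rewrite (rint_derive (fun t => t ^ 3 / 3)).
    - field.
    - intros t; unfold nsq; simpl; auto_derive; auto; field.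
    - unfold nsq; simpl; cont. }
  rewrite E.
  assert (N : 8 * PI / (2 * INR n + 1) < eps).
  { assert (0 < INR n).
    { apply Rlt_trans with (2 := Hn); apply Rdiv_lt_0_compat; lra. }
    apply Rmult_lt_reg_r with ((2 * INR n + 1) / eps).
    - apply Rdiv_lt_0_compat; lra.
    - replace (8 * PI / (2 * INR n + 1) * ((2 * INR n + 1) / eps)) with
        (8 * PI / eps) by (field; lra).
      replace (eps * ((2 * INR n + 1) / eps)) with (2 * INR n + 1) by (field; lra).
      lra. }
  assert (2 * PI * (2 * (PI ^ 2 / 6 - 2 / (2 * INR n + 1))) <=
    2 * PI * lsum (fun k => coef it k ^ 2) L) by (apply Rmult_le_compat_l; lra).
  replace (2 * PI * (2 * (PI ^ 2 / 6 - 2 / (2 * INR n + 1)))) with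
    (2 * PI ^ 3 / 3 - 8 * PI / (2 * INR n + 1)) in H.
  - lra.
  - generalize (pos_INR n); intros; field; lra.
Qed.

(* Parseval's identity for F and the function t |-> it. *)
Lemma coef_mult_it (F : R -> C) (n : Z) : contC F ->
  has_Zsum (fun k => coef it k * coef F (n - k))
    (coef (fun t => Cmult (F t) (it t)) n).
Proof.
  intros CF eps He.
  set (A := rint (fun t => nsq (F t)) (- PI) PI).
  assert (HA : 0 <= A).
  { generalize PI_RGT_0; intros P; replace 0 with (rint (fun _ => 0) (- PI) PI)
      by (rewrite rint_const; ring).
    destruct CF; apply rint_le; [lra | cont | unfold nsq; cont |].
    intros; apply nsq_nonneg. }
  (* With this weight, [e * A] and [/ e * d] are both at most [eps], where [d] is the approximation
     error, made smaller than [e * eps]. The 1 guards against A = 0. *)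
  set (e := eps / (A + 1)).
  assert (He' : 0 < e) by (apply Rdiv_lt_0_compat; lra).
  assert (HeA : e * A <= eps).
  { apply Rle_trans with (e * (A + 1)); [apply Rmult_le_compat_l; lra|].
    unfold e; right; field; lra. }
  destruct (trig_it_converges (e * eps)) as (L0 & H).
  { now apply Rmult_lt_0_compat. }
  exists L0; intros L D I; specialize (H L D I).
  assert (CT : contC (fun t => Cminus (it t) (trig (coef it) L t))).
  { unfold trig; split; simpl; cont. }
  generalize (coef_mult_bound F _ n e CF CT He').
  rewrite (coef_mult_trig F it (coef it) L n CF contC_it).
  fold A; set (d := rint (fun t => nsq (Cminus (it t) _)) _ _) in *.
  assert (/ e * d < eps).
  { apply Rmult_lt_reg_l with e; [easy|].
    rewrite <- Rmult_assoc, Rinv_r, Rmult_1_l by lra.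
    exact H. }
  generalize PI2_1; intros P B.
  rewrite Rabs_minus_sym.
  rewrite Rabs_mult, (Rabs_right (2 * PI)) in B by lra.
  set (x := Rabs _) in *.
  assert (0 <= x) by apply Rabs_pos.
  (* The bound reads 2 pi x <= (e A + d / e) / 2 < eps, and 2 pi > 1. *)
  nra.
Qed.

(** * From sequences on Z to functions on the circle *)

Lemma coef_mult_const (a : R) (F : R -> C) (n : Z) : contC F ->
  coef (fun t => Cmult (RtoC a) (F t)) n = a * coef F n.
Proof.
  intros (F1 & F2); apply Rmult_eq_reg_l with (2 * PI).
  - rewrite <- coef_int; transitivity (a * (2 * PI * coef F n)); [|ring].
    rewrite <- coef_int, <- rint_scal by cont.
    apply rint_eq; intros t; simpl; ring.
  - generalize PI_RGT_0; lra.
Qed.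

Lemma coef_plus (F G : R -> C) (n : Z) : contC F -> contC G ->
  coef (fun t => Cplus (F t) (G t)) n = coef F n + coef G n.
Proof.
  intros (F1 & F2) (G1 & G2); apply Rmult_eq_reg_l with (2 * PI).
  - rewrite Rmult_plus_distr_l, <- !coef_int, <- rint_plus by cont.
    apply rint_eq; intros t; simpl; ring.
  - generalize PI_RGT_0; lra.
Qed.

Definition cis (t : R) : C := (cos t, sin t).

Lemma contC_cis : contC cis.
Proof. split; simpl; cont. Qed.

Lemma qpow_0_coef (n : Z) : qpow 0 n = RtoC (coef (itpow 0) n).
Proof.
  unfold coef; simpl; rewrite (rint_eq _ (fun t => cos (IZR n * t))), rint_cos
    by (intros; ring).
  unfold qpow; destruct (Z.eq_dec n 0); f_equal; field; apply PI_neq0.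
Qed.

Lemma qpow_1_coef (n : Z) : qpow 1 n = RtoC (coef cis n).
Proof.
  unfold coef; simpl.
  rewrite (rint_eq _ (fun t => cos (IZR (n - 1) * t))), rint_cos.
  - unfold qpow; destruct (Z.eq_dec n 1), (Z.eq_dec (n - 1) 0); try lia;
      f_equal; field; apply PI_neq0.
  - intros t; rewrite minus_IZR, Rmult_minus_distr_r, Rmult_1_l, cos_minus; ring.
Qed.

Lemma has_Zsum_ext (h g : Z -> R) (l : R) :
  (forall k, h k = g k) -> has_Zsum h l -> has_Zsum g l.
Proof.
  intros E H eps He; destruct (H eps He) as (L0 & HL); exists L0; intros L.
  rewrite <- (lsum_ext h g L E); apply HL.
Qed.

(** [conv] is built on the total operator [ZSeries]; the unordered sum of [coef_mult_it] both
    ensures convergence and identifies the value. *)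
Lemma conv_coef (F : R -> C) (phi : Z -> C) (n : Z) : contC F ->
  (forall k, phi k = RtoC (coef F k)) ->
  conv phi tau n = RtoC (coef (fun t => Cmult (F t) (it t)) n).
Proof.
  intros CF Hphi; unfold conv, CZSeries, RtoC; f_equal; apply has_Zsum_ZSeries.
  (* In [coef_mult_it] the factor from [tau] carries the index k, in [conv] it carries n - k, hence
     the reflection. *)
  - apply (has_Zsum_ext (fun k => coef it (n - k) * coef F (n - (n - k)))).
    + intros k; rewrite Hphi, tau_coef; simpl.
      replace (n - (n - k))%Z with k by lia; ring.
    + apply (has_Zsum_reflect (fun k => coef it k * coef F (n - k))).
      now apply coef_mult_it.
  - apply (has_Zsum_ext (fun _ => 0)); [|apply has_Zsum_zero].
    intros k; rewrite Hphi, tau_coef; simpl; ring.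
Qed.

Lemma conv_pow_coef (m : nat) (n : Z) :
  conv_pow tau m n = RtoC (coef (itpow m) n).
Proof.
  revert n; induction m as [|m IH]; intros n; [apply qpow_0_coef|].
  simpl; now apply conv_coef; [apply contC_itpow|].
Qed.

(** Carries Bessel's inequality over to [L2norm]: a uniformly small continuous function has a
    coefficient sequence of small norm. *)
Lemma L2_coef (F : R -> C) (psi : Z -> C) : contC F ->
  (forall n, psi n = RtoC (coef F n)) ->
  L2 psi /\
  L2norm psi <= sqrt (rint (fun t => nsq (F t)) (- PI) PI / (2 * PI)).
Proof.
  intros CF Hpsi.
  assert (E : forall n, coef F n ^ 2 = Cmod (psi n) ^ 2).
  { intros n; rewrite Hpsi, Cmod_R; symmetry; apply pow2_abs. }
  destruct (coef_sqr_ZSeries F CF) as ((E1 & E2) & B); split.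
  - split; [apply (ex_series_ext _ _ (fun n => E (Z.of_nat n)) E1)|].
    apply (ex_series_ext _ _ (fun n => E (- Z.of_nat (S n))%Z) E2).
  - apply sqrt_le_1_alt; unfold ZSeries in *.
    rewrite <- (Series_ext _ _ (fun n => E (Z.of_nat n))).
    now rewrite <- (Series_ext _ _ (fun n => E (- Z.of_nat (S n))%Z)).
Qed.

(** * The exponential series *)

(* exp_rem N t = (sum_{m <= N} (it)^m / m!) - e^{it}. *)
Fixpoint exp_rem (N : nat) (t : R) : C :=
  match N with
  | O => Cplus (itpow 0 t) (Cmult (RtoC (-1)) (cis t))
  | S N' => Cplus (exp_rem N' t) (Cmult (RtoC (/ INR (fact N))) (itpow N t))
  end.

Lemma contC_exp_rem (N : nat) : contC (exp_rem N).
Proof.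
  induction N as [|N IH].
  - apply contC_Cplus; [apply contC_itpow|].
    apply contC_Cmult; [apply contC_const | apply contC_cis].
  - apply contC_Cplus; [exact IH|].
    apply contC_Cmult; [apply contC_const | apply contC_itpow].
Qed.

Lemma exp_partial_sum_coef (N : nat) (n : Z) :
  exp_partial_sum tau N n =
  RtoC (coef (fun t => Cplus (exp_rem N t) (cis t)) n).
Proof.
  rewrite (coef_plus (exp_rem N) cis n (contC_exp_rem N) contC_cis).
  unfold exp_partial_sum; induction N as [|N IH].
  - rewrite sum_O; change (exp_rem 0) with
      (fun t => Cplus (itpow 0 t) (Cmult (RtoC (-1)) (cis t))).
    rewrite (coef_plus (itpow 0) (fun t => Cmult (RtoC (-1)) (cis t))),
      coef_mult_const, conv_pow_coef.
    + change (fact 0) with 1%nat; rewrite <- RtoC_div by apply R1_neq_R0.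
      f_equal; simpl INR; field.
    + apply contC_cis.
    + apply contC_itpow.
    + apply contC_Cmult; [apply contC_const | apply contC_cis].
  - rewrite sum_Sn, IH, conv_pow_coef.
    rewrite <- RtoC_div by apply INR_fact_neq_0.
    change (plus ?x ?y) with (Cplus x y); rewrite <- RtoC_plus; f_equal.
    change (exp_rem (S N)) with (fun t => Cplus (exp_rem N t)
      (Cmult (RtoC (/ INR (fact (S N)))) (itpow (S N) t))).
    rewrite (coef_plus (exp_rem N)), coef_mult_const.
    + field; apply INR_fact_neq_0.
    + apply contC_itpow.
    + apply contC_exp_rem.
    + apply contC_Cmult; [apply contC_const | apply contC_itpow].
Qed.

(** * Derivatives and size of the exponential remainder *)

Lemma is_derive_Rmult (f g : R -> R) (x a b : R) :
  is_derive f x a -> is_derive g x b ->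
  is_derive (fun t => f t * g t) x (a * g x + f x * b).
Proof. intros Hf Hg; apply (is_derive_mult f g x a b Hf Hg Rmult_comm). Qed.

Lemma is_derive_eq (f g : R -> R) (x a b : R) :
  is_derive f x a -> (forall t, f t = g t) -> a = b -> is_derive g x b.
Proof. intros H E <-; now apply (is_derive_ext f g). Qed.

(** Multiplication by i sends (a, b) to (-b, a), so the two components together encode d/dt
    (it)^(m+1) = i (m+1) (it)^m. *)
Lemma is_derive_itpow (m : nat) (t : R) :
  is_derive (fun t => fst (itpow (S m) t)) t (- INR (S m) * snd (itpow m t)) /\
  is_derive (fun t => snd (itpow (S m) t)) t (INR (S m) * fst (itpow m t)).
Proof.
  induction m as [|m (IH1 & IH2)].
  - split; simpl; auto_derive; auto; ring.
  - split.
    + apply (is_derive_eq (fun t => -1 * (snd (itpow (S m) t) * t)) _ _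
        (-1 * (INR (S m) * fst (itpow m t) * t + snd (itpow (S m) t) * 1))).
      * apply is_derive_scal.
        apply (is_derive_Rmult _ (fun t => t) t _ 1 IH2 (is_derive_id t)).
      * intros s; simpl; ring.
      * rewrite (S_INR (S m)); simpl; ring.
    + apply (is_derive_eq (fun t => fst (itpow (S m) t) * t) _ _
        (- INR (S m) * snd (itpow m t) * t + fst (itpow (S m) t) * 1)).
      * apply (is_derive_Rmult _ (fun t => t) t _ 1 IH1 (is_derive_id t)).
      * intros s; simpl; ring.
      * rewrite (S_INR (S m)); simpl; ring.
Qed.

(** Differentiation turns (it)^m / m! into i (it)^(m-1) / (m-1)! and e^{it} into i e^{it}, so it
    lowers the rank of the remainder by one, up to the factor i. *)
Lemma is_derive_exp_rem (N : nat) (t : R) :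
  is_derive (fun t => fst (exp_rem (S N) t)) t (- snd (exp_rem N t)) /\
  is_derive (fun t => snd (exp_rem (S N) t)) t (fst (exp_rem N t)).
Proof.
  induction N as [|N (IH1 & IH2)].
  - split; simpl; auto_derive; auto; field.
  - destruct (is_derive_itpow (S N) t) as (D1 & D2).
    assert (E : INR (fact (S (S N))) = INR (S (S N)) * INR (fact (S N)))
      by (rewrite <- mult_INR; reflexivity).
    assert (P1 : INR (S (S N)) <> 0) by (apply not_0_INR; lia).
    assert (P2 := INR_fact_neq_0 (S N)).
    split.
    + apply (is_derive_eq (fun t => fst (exp_rem (S N) t) +
        / INR (fact (S (S N))) * fst (itpow (S (S N)) t)) _ _
        (- snd (exp_rem N t) +
        / INR (fact (S (S N))) * (- INR (S (S N)) * snd (itpow (S N) t)))).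
      * apply (is_derive_plus (fun t => fst (exp_rem (S N) t))); [exact IH1|].
        now apply is_derive_scal.
      * intros s; change (exp_rem (S (S N)) s) with (Cplus (exp_rem (S N) s)
          (Cmult (RtoC (/ INR (fact (S (S N))))) (itpow (S (S N)) s))).
        unfold Cplus, Cmult, RtoC; cbn [fst snd]; ring.
      * change (exp_rem (S N) t) with (Cplus (exp_rem N t)
          (Cmult (RtoC (/ INR (fact (S N)))) (itpow (S N) t))).
        unfold Cplus, Cmult, RtoC; cbn [fst snd].
        rewrite E; field; auto.
    + apply (is_derive_eq (fun t => snd (exp_rem (S N) t) +
        / INR (fact (S (S N))) * snd (itpow (S (S N)) t)) _ _
        (fst (exp_rem N t) +
        / INR (fact (S (S N))) * (INR (S (S N)) * fst (itpow (S N) t)))).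
      * apply (is_derive_plus (fun t => snd (exp_rem (S N) t))); [exact IH2|].
        now apply is_derive_scal.
      * intros s; change (exp_rem (S (S N)) s) with (Cplus (exp_rem (S N) s)
          (Cmult (RtoC (/ INR (fact (S (S N))))) (itpow (S (S N)) s))).
        unfold Cplus, Cmult, RtoC; cbn [fst snd]; ring.
      * change (exp_rem (S N) t) with (Cplus (exp_rem N t)
          (Cmult (RtoC (/ INR (fact (S N)))) (itpow (S N) t))).
        unfold Cplus, Cmult, RtoC; cbn [fst snd].
        rewrite E; field; auto.
Qed.

Lemma exp_rem_0 (N : nat) : exp_rem N 0 = RtoC 0.
Proof.
  induction N as [|N IH].
  - simpl; unfold cis; rewrite cos_0, sin_0.
    unfold Cplus, Cmult, RtoC; simpl; f_equal; ring.
  - simpl exp_rem; rewrite IH; unfold it, Cplus, Cmult, RtoC; cbn [fst snd].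
    f_equal; ring.
Qed.

(** The mean value theorem is applied to K x^(n+1) / (n+1) - f(x), which is 0 at 0 and has
    nonnegative derivative for x >= 0. *)
Lemma antiderivative_upper_bound (f g : R -> R) (K : R) (n : nat) :
  f 0 = 0 -> (forall t, is_derive f t (g t)) ->
  (forall t, 0 <= t -> g t <= K * t ^ n) ->
  forall t, 0 <= t -> f t <= K * t ^ S n / INR (S n).
Proof.
  intros f0 Hf Hg t Ht.
  assert (P : INR (S n) <> 0) by (apply not_0_INR; lia).
  assert (D : forall x, is_derive (fun x => K * x ^ S n / INR (S n) + -1 * f x) x
    (K * x ^ n + -1 * g x)).
  { intros x; apply (is_derive_plus (fun x => K * x ^ S n / INR (S n))).
    - auto_derive; auto; simpl pred.
      change (match n with O => 1 | S _ => INR n + 1 end) with (INR (S n)).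
      field; auto.
    - now apply is_derive_scal. }
  destruct (MVT_gen _ 0 t _ (fun x _ => D x)) as (c & Hc & E).
  - intros x _; apply derivable_continuous_pt, ex_derive_Reals_0.
    eexists; apply D.
  - rewrite Rmin_left, Rmax_right in Hc by easy.
    assert (0 <= (K * c ^ n + -1 * g c) * (t - 0)).
    { apply Rmult_le_pos; [specialize (Hg c); lra | lra]. }
    replace (K * 0 ^ S n / INR (S n) + -1 * f 0) with 0 in E; [lra|].
    rewrite f0; simpl; field; auto.
Qed.

Lemma antiderivative_abs_bound (f g : R -> R) (K : R) (n : nat) :
  f 0 = 0 -> (forall t, is_derive f t (g t)) ->
  (forall t, Rabs (g t) <= K * Rabs t ^ n) ->
  forall t, Rabs (f t) <= K * Rabs t ^ S n / INR (S n).
Proof.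
  intros f0 Hf Hg.
  (* The sign [a] selects the side of the bound and the sign [b] the half-line, so four one-sided
     bounds give the absolute one. *)
  assert (A : forall a b, Rabs a = 1 -> Rabs b = 1 -> forall t, 0 <= t ->
    a * f (b * t) <= K * t ^ S n / INR (S n)).
  { intros a b Ha Hb.
    apply (antiderivative_upper_bound (fun t => a * f (b * t))
      (fun t => a * (b * g (b * t)))).
    - rewrite Rmult_0_r, f0; ring.
    - intros t; apply is_derive_scal.
      apply (is_derive_comp f (fun t => b * t)); [apply Hf|].
      auto_derive; auto; ring.
    - intros t Ht; eapply Rle_trans; [apply Rle_abs|].
      rewrite !Rabs_mult, Ha, Hb, !Rmult_1_l.
      eapply Rle_trans; [apply Hg|].
      rewrite Rabs_mult, Hb, Rmult_1_l, (Rabs_right t) by lra; lra. }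
  assert (H1 := Rabs_R1).
  assert (H2 : Rabs (-1) = 1) by (rewrite Rabs_left; lra).
  intros t; destruct (Rle_lt_dec 0 t) as [Ht|Ht].
  - rewrite (Rabs_right t) by lra.
    generalize (A 1 1 H1 H1 t Ht) (A (-1) 1 H2 H1 t Ht); rewrite !Rmult_1_l.
    intros; apply Rabs_le; lra.
  - rewrite (Rabs_left t) by lra.
    assert (Ht' : 0 <= - t) by lra.
    generalize (A 1 (-1) H1 H2 _ Ht') (A (-1) (-1) H2 H2 _ Ht').
    replace (-1 * - t) with t by ring.
    intros; apply Rabs_le; lra.
Qed.

Lemma exp_rem_bound (N : nat) (t : R) :
  Rabs (fst (exp_rem N t)) <= 2 / INR (fact N) * Rabs t ^ N /\
  Rabs (snd (exp_rem N t)) <= 2 / INR (fact N) * Rabs t ^ N.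
Proof.
  revert t; induction N as [|N IH]; intros t.
  (* Both components of 1 - e^{it} are at most 2 in absolute value, which is the source of the
     constant; each later integration from 0 contributes |t| / (N+1). *)
  - simpl; generalize (COS_bound t) (SIN_bound t); intros.
    split; apply Rabs_le; lra.
  - assert (E : 2 / INR (fact (S N)) * Rabs t ^ S N =
      2 / INR (fact N) * Rabs t ^ S N / INR (S N)).
    { change (fact (S N)) with (S N * fact N)%nat; rewrite mult_INR.
      field; split; [apply INR_fact_neq_0 | apply not_0_INR; lia]. }
    rewrite E; split.
    + apply (antiderivative_abs_bound (fun t => fst (exp_rem (S N) t))
        (fun t => - snd (exp_rem N t))).
      * now rewrite exp_rem_0.
      * intros s; apply is_derive_exp_rem.
      * intros s; rewrite Rabs_Ropp; apply IH.
    + apply (antiderivative_abs_bound (fun t => snd (exp_rem (S N) t))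
        (fun t => fst (exp_rem N t))).
      * now rewrite exp_rem_0.
      * intros s; apply is_derive_exp_rem.
      * intros s; apply IH.
Qed.

(** With X = pi^N / N!, each component is at most 2X on the interval, so the squared modulus is at
    most 8 X^2; rounding up to 9 X^2 gives a perfect square. *)
Lemma exp_rem_norm (N : nat) :
  rint (fun t => nsq (exp_rem N t)) (- PI) PI / (2 * PI) <=
  (3 * (PI ^ N / INR (fact N))) ^ 2.
Proof.
  generalize PI_RGT_0; intros P.
  apply Rmult_le_reg_l with (2 * PI); [lra|].
  replace (2 * PI * (rint (fun t => nsq (exp_rem N t)) (- PI) PI / (2 * PI)))
    with (rint (fun t => nsq (exp_rem N t)) (- PI) PI) by (field; lra).
  rewrite <- rint_const.
  destruct (contC_exp_rem N) as (C1 & C2).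
  apply rint_le; [lra | unfold nsq; cont | cont |].
  intros t Ht; destruct (exp_rem_bound N t) as (B1 & B2).
  set (X := PI ^ N / INR (fact N)).
  assert (B : 2 / INR (fact N) * Rabs t ^ N <= 2 * X).
  { replace (2 * X) with (2 / INR (fact N) * PI ^ N)
      by (unfold X; field; apply INR_fact_neq_0).
    assert (0 < / INR (fact N)) by apply Rinv_0_lt_compat, INR_fact_lt_0.
    apply Rmult_le_compat_l; [unfold Rdiv; lra|].
    apply pow_incr; split; [apply Rabs_pos | apply Rabs_le; lra]. }
  unfold nsq; rewrite <- (pow2_abs (fst _)), <- (pow2_abs (snd _)).
  assert (forall x, 0 <= x <= 2 * X -> x ^ 2 <= 4 * X ^ 2).
  { intros x Hx; replace (4 * X ^ 2) with ((2 * X) ^ 2) by ring.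
    now apply pow_incr. }
  assert (Rabs (fst (exp_rem N t)) ^ 2 <= 4 * X ^ 2).
  { apply H; split; [apply Rabs_pos | lra]. }
  assert (Rabs (snd (exp_rem N t)) ^ 2 <= 4 * X ^ 2).
  { apply H; split; [apply Rabs_pos | lra]. }
  generalize (pow2_ge_0 X); lra.
Qed.

Lemma L2_conv_pow_tau (m : nat) : L2 (conv_pow tau m).
Proof.
  apply (L2_coef (itpow m)); [apply contC_itpow | apply conv_pow_coef].
Qed.

Theorem theorem5 :
  L2 tau /\
  (forall m : nat, (1 <= m)%nat -> L2 (conv_pow tau m)) /\
  L2_converges (exp_partial_sum tau) (qpow 1).
Proof.
  split; [apply (L2_coef it); [apply contC_it | apply tau_coef]|].
  split; [intros m _; apply L2_conv_pow_tau|].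
  split; [|split].
  - intros N; apply (L2_coef (fun t => Cplus (exp_rem N t) (cis t))).
    + apply (contC_Cplus _ _ (contC_exp_rem N) contC_cis).
    + apply exp_partial_sum_coef.
  - apply (L2_coef cis); [apply contC_cis | apply qpow_1_coef].
  - apply (is_lim_seq_le_le (fun _ => 0) _
      (fun N => 3 * (PI ^ N / INR (fact N)))).
    + intros N; split; [apply sqrt_pos|].
      (* The error sequence consists of the Fourier coefficients of [exp_rem N], so its norm is
         controlled by the uniform bound on that remainder. *)
      destruct (L2_coef (exp_rem N)
        (fun n => Cminus (exp_partial_sum tau N n) (qpow 1 n))) as (_ & B).
      * apply contC_exp_rem.
      * intros n; rewrite exp_partial_sum_coef, qpow_1_coef.
        rewrite (coef_plus (exp_rem N) cis n (contC_exp_rem N) contC_cis).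
        rewrite <- RtoC_minus; f_equal; ring.
      * eapply Rle_trans; [exact B|].
        eapply Rle_trans; [apply sqrt_le_1_alt, exp_rem_norm|].
        rewrite sqrt_pow2; [lra|].
        apply Rmult_le_pos; [lra | apply Rlt_le, Rdiv_lt_0_compat].
        -- apply pow_lt, PI_RGT_0.
        -- apply INR_fact_lt_0.
    + apply is_lim_seq_const.
    + replace (Finite 0) with (Rbar_mult 3 0) by (simpl; f_equal; ring).
      apply is_lim_seq_scal_l, is_lim_seq_Reals, cv_speed_pow_fact.
Qed.
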